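(* There are $k^*\in\omega$ and total Turing functionals $\Psi_1,\ldots,\Psi_{k^*}:2^\omega\to 2^\omega$ such that, for every 1-random real $z\in 2^\omega$, there is some $\hat k\in\{1,\ldots,k^*\}$ with $z<_K\Psi_{\hat k}(z)$.
   Context: Fix an optimal (universal) prefix-free machine $U$, and for $\sigma\in 2^{<\omega}$ let $K(\sigma)=\min\{|p|:U(p)=\sigma\}$ be prefix-free Kolmogorov complexity. Reals are elements of $2^\omega$; $z\upharpoonright n$ is the prefix of $z$ of length $n$. For $z,\hat z\in 2^\omega$ write $z\leq_K\hat z$ if there is a constant $c$ such that $K(z\upharpoonright n)\leq K(\hat z\upharpoonright n)+c$ for all $n$; write $z<_K\hat z$ if $z\leq_K\hat z$ and $\hat z\not\leq_K z$. A real is 1-random if it is Martin-Löf random; equivalently (Levin--Schnorr) there is a constant $c$ with $K(z\upharpoonright n)\geq n-c$ for all $n$. A Turing functional is total if it is total on every oracle, i.e. $\Psi(z)\in 2^\omega$ is defined for every $z\in 2^\omega$. *)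

(* Defs.v *)
From Stdlib Require Cantor.
From mathcomp Require Import all_boot all_order all_algebra.
From mathcomp Require Import boolp.

Set Implicit Arguments.
Unset Strict Implicit.
Unset Printing Implicit Defensive.

Import Order.TTheory GRing.Theory Num.Theory.

Notation string := (seq bool).
Notation real := (nat -> bool).

(** ** Partial recursive functions relative to an oracle *)

(* Several arguments are packed into one number by the Cantor pairing, a
   bijection, so unary functions suffice. *)
Definition npair (x y : nat) : nat := Cantor.to_nat (x, y).
Definition nfst (x : nat) : nat := (Cantor.of_nat x).1.
Definition nsnd (x : nat) : nat := (Cantor.of_nat x).2.

Inductive code : Type :=
  | Zero
  | Succ
  | Fst
  | Snd
  | Query
  | Pair of code & code
  | Comp of code & code
  | Prec of code & code
  | Mu of code.

(* [eval A e x y]: the program [e] with oracle [A] halts on [x] with output [y].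
   [Prec f g] sends <a, 0> to f(a) and <a, n + 1> to g<a, <n, v>>, where v is
   its value at <a, n>.  [Mu f] sends x to the least y such that f<x, y> = 0,
   all of f<x, 0>, ..., f<x, y - 1> being defined and nonzero. *)
Fixpoint eval (A : real) (e : code) (x y : nat) {struct e} : Prop :=
  match e with
  | Zero => y = 0
  | Succ => y = x.+1
  | Fst => y = nfst x
  | Snd => y = nsnd x
  | Query => y = A x
  | Pair f g => exists u v, [/\ eval A f x u, eval A g x v & y = npair u v]
  | Comp f g => exists u, eval A g x u /\ eval A f u y
  | Prec f g =>
      (fix rec (n r : nat) {struct n} : Prop :=
         match n with
         | 0 => eval A f (nfst x) r
         | m.+1 =>
             exists v, rec m v /\ eval A g (npair (nfst x) (npair m v)) r
         end) (nsnd x) y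
  | Mu f =>
      eval A f (npair x y) 0 /\
      forall i, i < y -> exists v, eval A f (npair x i) v.+1
  end.

(* Plain computability is computability relative to the empty oracle. *)
Definition no_oracle : real := fun=> false.

Definition total_turing_functional (Psi : real -> real) : Prop :=
  exists e : code, forall (z : real) (n y : nat),
    eval z e n y <-> y = Psi z n.

(** ** Prefix-free machines and prefix-free complexity *)

(* Bijective base-2 numeration (digits 1 and 2), hence a bijection. *)
Fixpoint string_code (s : string) : nat :=
  if s is b :: s' then (b + (string_code s').*2).+1 else 0.

Definition partial_computable (M : string -> option string) : Prop :=
  exists e : code, forall (p : string) (y : nat),
    eval no_oracle e (string_code p) y <-> omap string_code (M p) = Some y.

Definition prefix_free_machine (M : string -> option string) : Prop :=
  partial_computable M /\
  forall p q : string, isSome (M p) -> isSome (M q) -> prefix p q -> p = q.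

Definition optimal_machine (U : string -> option string) : Prop :=
  prefix_free_machine U /\
  forall M : string -> option string, prefix_free_machine M ->
    exists c : nat, forall p s : string, M p = Some s ->
      exists2 q : string, U q = Some s & size q <= size p + c.

Definition description_length (U : string -> option string) (s : string) :
  pred nat := fun n => `[< exists2 p : string, U p = Some s & size p = n >].

(* The default value 0 is not used when [U] is optimal: every string then has
   a [U]-description. *)
Definition K (U : string -> option string) (s : string) : nat :=
  if pselect (exists n, description_length U s n) is left ex_n
  then ex_minn ex_n else 0.

Definition restr (z : real) (n : nat) : string := mkseq z n.

Definition leK (U : string -> option string) (z w : real) : Prop :=
  exists c : nat, forall n : nat, K U (restr z n) <= K U (restr w n) + c.

Definition ltK (U : string -> option string) (z w : real) : Prop :=
  leK U z w /\ ~ leK U w z.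

(** ** Martin-Löf randomness *)

(* The uniform measure of the clopen set generated by the strings of [W] of
   length at most [n]. *)
Definition stage_measure (W : string -> Prop) (n : nat) : rat :=
  (#|[set s : n.-tuple bool | `[< exists2 t, W t & prefix t s >]]|%:R
     / 2%:R ^+ n)%R.

(* The uniform measure of the open set generated by [W] is at most [q].  That
   set is the increasing union of the clopen sets above, so its measure is the
   supremum of their measures. *)
Definition measure_le (W : string -> Prop) (q : rat) : Prop :=
  forall n : nat, (stage_measure W n <= q)%R.

Definition uniformly_ce (V : nat -> string -> Prop) : Prop :=
  exists e : code, forall (m : nat) (s : string),
    V m s <-> exists y, eval no_oracle e (npair m (string_code s)) y.

Definition ml_test (V : nat -> string -> Prop) : Prop :=
  uniformly_ce V /\ forall m : nat, measure_le (V m) (2%:R ^- m)%R.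

Definition in_open (W : string -> Prop) (z : real) : Prop :=
  exists n : nat, W (restr z n).

Definition one_random (z : real) : Prop :=
  forall V : nat -> string -> Prop, ml_test V -> ~ forall m, in_open (V m) z.

(* Main.v *)
(** The functional [psi] permutes the bits of the oracle inside consecutive
    blocks; write [a] for the width of a block.  Inside a block, the strings
    [0^i 1 b 0^(a-i)] with [i <= a] and [size b = a - 1] are permuted cyclically:
    for [i < a] the string is shifted right by one bit, and [0^a 1 b] is sent to
    [1 b 0^a]; all other strings are fixed.  A prefix of [z] is then computable
    from the prefix of [psi z] of the same length and two bits of advice: complete
    blocks are inverted, and inside an incomplete block a shift costs only its
    last bit, while in the case [0^a 1 b] the prefix of [z] reads [0^t] as long
    as [t <= a].  Hence [z] is [leK]-below [psi z].

    When [0^a 1] occurs at a block of [z] starting at [n], the prefix of [z] of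
    length [n + a] is compressible: it is described by the block and [n] bits.
    But the prefix of [psi z] of length [n + a] determines that of [z] of length
    [n + 2 a], which is incompressible if [z] is random.  The width of the block
    with index [npair s i] is [3 s], and [2 ^ (4 s)] of these indices cost about
    [5 s] bits each, which is less than the gain [6 s]; and since [3 s + 1] is
    less than [4 s], a random [z] has such an occurrence for all large [s]. *)

From Stdlib Require Cantor.
Require Import Defs.
From mathcomp Require Import all_boot all_order all_algebra.
From mathcomp Require Import boolp zify.

Set Implicit Arguments.
Unset Strict Implicit.
Unset Printing Implicit Defensive.

(** * Computable functions *)

Lemma nfst_npair x y : nfst (npair x y) = x.
Proof. by rewrite /nfst /npair Cantor.cancel_of_to. Qed.

Lemma nsnd_npair x y : nsnd (npair x y) = y.
Proof. by rewrite /nsnd /npair Cantor.cancel_of_to. Qed.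

Lemma npair_eta x : npair (nfst x) (nsnd x) = x.
Proof.
rewrite /npair /nfst /nsnd -[RHS]Cantor.cancel_to_of.
by case: (Cantor.of_nat x).
Qed.

Definition npairE := (nfst_npair, nsnd_npair, npair_eta).

(** One code serves all oracles, so the same closure lemmas apply to [psi] and, when the oracle is
    ignored, to machines. *)
Definition computable (F : real -> nat -> nat) : Prop :=
  exists e : code, forall A x y, eval A e x y <-> y = F A x.

Lemma computable_ext (F G : real -> nat -> nat) :
  (forall A x, F A x = G A x) -> computable F -> computable G.
Proof. by move=> eqFG [e eP]; exists e => A x y; rewrite eP eqFG. Qed.

Lemma computable_pair F G : computable F -> computable G ->
  computable (fun A x => npair (F A x) (G A x)).
Proof.
move=> [f fP] [g gP]; exists (Pair f g) => A x y /=; split.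
  by move=> [u [v [/fP -> /gP -> ->]]].
by move=> ->; exists (F A x), (G A x); split=> //; [apply/fP | apply/gP].
Qed.

Lemma computable_comp F G : computable F -> computable G ->
  computable (fun A x => F A (G A x)).
Proof.
move=> [f fP] [g gP]; exists (Comp f g) => A x y /=; split.
  by move=> [u [/gP -> /fP ->]].
by move=> ->; exists (G A x); split; [apply/gP | apply/fP].
Qed.

Lemma computable_id : computable (fun _ x => x).
Proof.
exists (Pair Fst Snd) => A x y /=; split.
  by move=> [u [v [-> -> ->]]]; rewrite npairE.
by move=> ->; exists (nfst x), (nsnd x); rewrite npairE.
Qed.

Lemma computable_fst F : computable F -> computable (fun A x => nfst (F A x)).
Proof. by apply: (@computable_comp (fun _ => nfst)); exists Fst. Qed.

Lemma computable_snd F : computable F -> computable (fun A x => nsnd (F A x)).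
Proof. by apply: (@computable_comp (fun _ => nsnd)); exists Snd. Qed.

Lemma computable_succ F : computable F -> computable (fun A x => (F A x).+1).
Proof. by apply: (@computable_comp (fun _ => succn)); exists Succ. Qed.

Lemma computable_query F : computable F -> computable (fun A x => A (F A x)).
Proof. by apply: (@computable_comp (fun A x => A x)); exists Query. Qed.

Lemma computable_const n : computable (fun _ _ => n).
Proof.
by elim: n => [|n IHn]; [exists Zero | apply: computable_succ].
Qed.

Lemma computable_app2 (F : real -> nat -> nat -> nat) X Y :
    computable (fun A u => F A (nfst u) (nsnd u)) ->
    computable X -> computable Y ->
  computable (fun A x => F A (X A x) (Y A x)).
Proof.
move=> cF cX cY; apply: computable_ext (computable_comp cF (computable_pair cX cY)).
by move=> A x; rewrite !npairE.
Qed.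

(** [Prec] is run on the pair of [x] and [N A x]; the first component keeps the parameter [x]
    available at every step. The loops below reduce to this one. *)
Lemma computable_iteri F G N :
    computable N ->
    computable (fun A u => G A (nfst u) (nfst (nsnd u)) (nsnd (nsnd u))) ->
    computable F ->
  computable (fun A x => iteri (N A x) (G A x) (F A x)).
Proof.
move=> cN [g gP] [f fP].
suff [e eP] : computable (fun A u => iteri (nsnd u) (G A (nfst u)) (F A (nfst u))).
  apply: computable_ext (computable_comp (ex_intro _ e eP)
    (computable_pair computable_id cN)).
  by move=> A x; rewrite !npairE.
exists (Prec f g) => A u /=; elim: (nsnd u) => [|n IHn] y /=; first exact: fP.
split.
  by move=> [v [/IHn -> /gP]]; rewrite !npairE.
move=> ->; eexists; split; first exact/IHn.
by apply/gP; rewrite !npairE.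
Qed.

(** A branch is a loop of length 0 or 1. *)
Lemma computable_if (P : real -> nat -> bool) F G :
    computable (fun A x => P A x) -> computable F -> computable G ->
  computable (fun A x => if P A x then F A x else G A x).
Proof.
move=> cP cF cG.
apply: (@computable_ext (fun A x => iteri (P A x) (fun _ _ => F A x) (G A x))).
  by move=> A x; case: (P A x).
apply: computable_iteri => //.
exact: computable_comp cF (computable_fst computable_id).
Qed.

Lemma computable_ifb (P Q R : real -> nat -> bool) :
    computable (fun A x => P A x) -> computable (fun A x => Q A x) ->
    computable (fun A x => R A x) ->
  computable (fun A x => if P A x then Q A x else R A x).
Proof.
move=> cP cQ cR; apply: computable_ext (computable_if cP cQ cR).
by move=> A x; case: (P A x).
Qed.

Lemma computable_pred F : computable F -> computable (fun A x => (F A x).-1).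
Proof.
move=> cF; apply: (@computable_ext (fun A x => iteri (F A x) (fun i _ => i) 0)).
  by move=> A x; case: (F A x).
apply: computable_iteri (computable_const 0) => //.
exact: computable_fst (computable_snd computable_id).
Qed.

Lemma computable_addn F G : computable F -> computable G ->
  computable (fun A x => F A x + G A x).
Proof.
move=> cF cG.
apply: (@computable_ext (fun A x => iteri (F A x) (fun _ r => r.+1) (G A x))).
  by move=> A x; elim: (F A x) => //= n ->.
apply: computable_iteri => //.
exact: computable_succ (computable_snd (computable_snd computable_id)).
Qed.

Lemma computable_subn F G : computable F -> computable G ->
  computable (fun A x => F A x - G A x).
Proof.
move=> cF cG.
apply: (@computable_ext (fun A x => iteri (G A x) (fun _ r => r.-1) (F A x))).
  by move=> A x; elim: (G A x) => [|n /= ->]; rewrite ?subn0 ?subnS.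
apply: computable_iteri => //.
exact: computable_pred (computable_snd (computable_snd computable_id)).
Qed.

Lemma computable_eq0 F : computable F -> computable (fun A x => F A x == 0).
Proof.
move=> cF.
apply: (@computable_ext (fun A x => iteri (F A x) (fun _ _ => 0) 1)).
  by move=> A x; case: (F A x).
by apply: computable_iteri => //; apply: computable_const.
Qed.

Lemma computable_neg (P : real -> nat -> bool) :
  computable (fun A x => P A x) -> computable (fun A x => ~~ P A x).
Proof.
by move=> /computable_eq0; apply: computable_ext => A x; case: (P A x).
Qed.

Lemma computable_and (P Q : real -> nat -> bool) :
    computable (fun A x => P A x) -> computable (fun A x => Q A x) ->
  computable (fun A x => P A x && Q A x).
Proof.
move=> cP cQ; apply: (computable_ifb (R := fun _ _ => false)) => //.
exact: computable_const 0.
Qed.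

Lemma computable_leq F G : computable F -> computable G ->
  computable (fun A x => F A x <= G A x).
Proof. by move=> cF cG; apply: computable_eq0 (computable_subn cF cG). Qed.

Lemma computable_eqn F G : computable F -> computable G ->
  computable (fun A x => F A x == G A x).
Proof.
move=> cF cG; apply: computable_ext (computable_and (computable_leq cF cG)
  (computable_leq cG cF)) => A x.
by rewrite eqn_leq.
Qed.

Lemma computable_odd F : computable F -> computable (fun A x => odd (F A x)).
Proof.
move=> cF.
apply: (@computable_ext (fun A x => iteri (F A x) (fun _ r => r == 0) 0)).
  by move=> A x; elim: (F A x) => //= n ->; case: odd.
apply: computable_iteri (computable_const 0) => //.
exact: computable_eq0 (computable_snd (computable_snd computable_id)).
Qed.

Lemma computable_half F : computable F -> computable (fun A x => (F A x)./2).
Proof.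
move=> cF.
apply: (@computable_ext (fun A x => iteri (F A x) (fun i r => odd i + r) 0)).
  by move=> A x; elim: (F A x) => //= n ->; rewrite uphalf_half.
apply: computable_iteri (computable_const 0) => //.
apply: computable_addn (computable_snd (computable_snd computable_id)).
exact: computable_odd (computable_fst (computable_snd computable_id)).
Qed.

Lemma computable_find (P : real -> nat -> nat -> bool) N :
    computable N -> computable (fun A u => P A (nfst u) (nsnd u)) ->
  computable (fun A x => find (P A x) (iota 0 (N A x))).
Proof.
move=> cN cP.
(* After [i] steps [r] is the least witness below [i], or [i] if there is none; so [r < i] records
   success. *)
pose step A x i r := if r < i then r else if P A x i then i else i.+1.
apply: (@computable_ext (fun A x => iteri (N A x) (step A x) 0)).
  move=> A x; elim: (N A x) => // n IHn; rewrite [LHS]/= IHn -[in RHS]addn1.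
  rewrite iotaD find_cat has_find size_iota /step /= add0n.
  by case: ifP => // _; case: ifP => _; rewrite ?addn0 ?addn1.
apply: computable_iteri (computable_const 0) => //.
have c2 := computable_snd computable_id.
apply: computable_if (computable_snd c2) _.
  exact: computable_leq (computable_succ (computable_snd c2)) (computable_fst c2).
apply: computable_if (computable_fst c2) (computable_succ (computable_fst c2)).
exact: computable_app2 (fun A x y => P A x y) _ _ cP (computable_fst computable_id)
  (computable_fst c2).
Qed.

Lemma computable_has (P : real -> nat -> nat -> bool) N :
    computable N -> computable (fun A u => P A (nfst u) (nsnd u)) ->
  computable (fun A x => has (P A x) (iota 0 (N A x))).
Proof.
move=> cN cP; apply: computable_ext (computable_leq (computable_succ
  (computable_find cN cP)) cN) => A x.
by rewrite has_find size_iota.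
Qed.

Lemma computable_all (P : real -> nat -> nat -> bool) N :
    computable N -> computable (fun A u => P A (nfst u) (nsnd u)) ->
  computable (fun A x => all (P A x) (iota 0 (N A x))).
Proof.
move=> cN cP; apply: computable_ext (computable_neg (computable_has cN
  (computable_neg cP))) => A x.
by rewrite -[in RHS](eq_all (fun i => negbK (P A x i))) all_predC.
Qed.

(** * Binary strings and their codes *)

Lemma string_code_behead s : string_code (behead s) = (string_code s).-1./2.
Proof. by case: s => [|b s] //=; rewrite half_bit_double. Qed.

Lemma string_code_drop k s :
  string_code (drop k s) = iter k (fun c => c.-1./2) (string_code s).
Proof.
by elim: k => [|k IHk]; rewrite ?drop0 // -add1n -drop_drop drop1
  string_code_behead IHk.
Qed.

(** The digits being 1 and 2, predecessor followed by halving deletes the head, and the parity of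
    the predecessor is the head. The code 0 of the empty string yields the default [false]. *)
Lemma string_code_nth k s :
  nth false s k = odd (iter k (fun c => c.-1./2) (string_code s)).-1.
Proof.
rewrite -string_code_drop -[k in LHS]addn0 -nth_drop.
by case: (drop k s) => //= b s'; rewrite oddD odd_double addbF oddb.
Qed.

Lemma string_code_inj : injective string_code.
Proof.
elim=> [|b s IHs] [|b' s'] //= [] eq_c; suff: b = b' by move=> eq_b;
  rewrite eq_b in eq_c *; congr cons; apply: IHs; lia.
by have := congr1 odd eq_c; rewrite !oddD !odd_double !addbF !oddb.
Qed.

Fixpoint string_decode_rec (fuel c : nat) : string :=
  if fuel is fuel'.+1 then
    if c is c'.+1 then odd c' :: string_decode_rec fuel' c'./2 else [::]
  else [::].

Definition string_decode (c : nat) : string := string_decode_rec c c.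

Lemma string_decodeK : cancel string_decode string_code.
Proof.
move=> c; rewrite /string_decode.
suff: forall n k, k <= n -> string_code (string_decode_rec n k) = k by apply.
elim=> [|n IHn] [|k] //= le_kn; rewrite IHn ?odd_double_half //.
by lia.
Qed.

Lemma string_codeK : cancel string_code string_decode.
Proof. by move=> s; apply: string_code_inj; rewrite string_decodeK. Qed.

Lemma size_string_code s : size s <= string_code s.
Proof. by elim: s => //= b s IHs; lia. Qed.

Lemma computable_decode F : computable F ->
  computable (fun A x => string_code (string_decode (F A x))).
Proof. by apply: computable_ext => A x; rewrite string_decodeK. Qed.

Lemma computable_iter_half F N : computable F -> computable N ->
  computable (fun A x => iter (N A x) (fun c => c.-1./2) (F A x)).
Proof.
move=> cF cN; apply: (@computable_ext
    (fun A x => iteri (N A x) (fun _ r => r.-1./2) (F A x))).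
  by move=> A x; elim: (N A x) => //= n ->.
apply: computable_iteri => //; apply: computable_half; apply: computable_pred.
exact: computable_snd (computable_snd computable_id).
Qed.

Lemma computable_nth (S : real -> nat -> string) N :
    computable (fun A x => string_code (S A x)) -> computable N ->
  computable (fun A x => nth false (S A x) (N A x)).
Proof.
move=> cS cN; apply: computable_ext (computable_odd (computable_pred
  (computable_iter_half cS cN))) => A x.
by rewrite string_code_nth.
Qed.

Lemma computable_size (S : real -> nat -> string) :
    computable (fun A x => string_code (S A x)) ->
  computable (fun A x => size (S A x)).
Proof.
move=> cS.
(* [r] grows until [drop r] is empty; the code of a string is at least its size, so that many steps
   suffice. *)
pose step A x (_ r : nat) :=
  if iter r (fun c => c.-1./2) (string_code (S A x)) == 0 then r else r.+1.
apply: (@computable_ext (fun A x => iteri (string_code (S A x)) (step A x) 0)).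
  move=> A x; have /minn_idPr <- := size_string_code (S A x).
  elim: (string_code (S A x)) => [|n /= ->]; first by rewrite min0n.
  rewrite /step -string_code_drop.
  have -> : (string_code (drop (minn n (size (S A x))) (S A x)) == 0)
      = (size (S A x) <= n).
    rewrite -[RHS]subn_eq0 /minn; case: ltnP => [lt_n | le_n].
      rewrite -size_drop; by case: drop.
    by rewrite drop_size.
  by case: leqP; lia.
apply: computable_iteri (computable_const 0) => //.
have c2 := computable_snd (computable_snd computable_id).
apply: computable_if (computable_succ c2) => //.
apply/computable_eq0/computable_iter_half => //.
exact: computable_comp cS (computable_fst computable_id).
Qed.

Lemma computable_mkseq (P : real -> nat -> nat -> bool) N :
    computable N -> computable (fun A u => P A (nfst u) (nsnd u)) ->
  computable (fun A x => string_code (mkseq (P A x) (N A x))).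
Proof.
move=> cN cP.
(* The code is built from the last bit to the first; [r + r] doubles the code of the tail. *)
pose step A x i r := (P A x (N A x - i.+1) + (r + r)).+1.
apply: (@computable_ext (fun A x => iteri (N A x) (step A x) 0)).
  move=> A x; rewrite /mkseq -[N A x in RHS]subn0.
  rewrite -{2}(subnn (N A x)).
  suff: forall n, n <= N A x -> iteri n (step A x) 0
     = string_code [seq P A x i | i <- iota (N A x - n) n].
    by move=> /(_ _ (leqnn _)); rewrite subnn subn0.
  elim=> //= n IHn le_n; rewrite IHn 1?ltnW // /step addnn.
  by rewrite subnSK.
apply: computable_iteri (computable_const 0) => //.
have c2 := computable_snd computable_id.
apply: computable_succ; apply: computable_addn.
  apply: (computable_app2 (F := fun A x y => P A x y)) => //.
    exact: computable_fst computable_id.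
  apply: computable_subn (computable_succ (computable_fst c2)).
  exact: computable_comp cN (computable_fst computable_id).
exact: computable_addn (computable_snd c2) (computable_snd c2).
Qed.

(** * Computability by the shape of the function *)

Ltac computability_hook := fail.

Ltac computability :=
  lazymatch goal with
  | |- computable (fun A x => x) => exact: computable_id
  | |- computable (fun A x => nfst (@?F A x)) =>
      apply: (@computable_fst F); computability
  | |- computable (fun A x => nsnd (@?F A x)) =>
      apply: (@computable_snd F); computability
  | |- computable (fun A x => npair (@?F A x) (@?G A x)) =>
      apply: (@computable_pair F G); computability
  | |- computable (fun A x => (@?F A x).+1) =>
      apply: (@computable_succ F); computability
  | |- computable (fun A x => (@?F A x).-1) =>
      apply: (@computable_pred F); computability
  | |- computable (fun A x => (@?F A x)./2) =>
      apply: (@computable_half F); computability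
  | |- computable (fun A x => @?F A x + @?G A x) =>
      apply: (@computable_addn F G); computability
  | |- computable (fun A x => @?F A x - @?G A x) =>
      apply: (@computable_subn F G); computability
  | |- computable (fun A x => nat_of_bool (@?F A x == 0)) =>
      apply: (@computable_eq0 F); computability
  | |- computable (fun A x => nat_of_bool (@?F A x == @?G A x)) =>
      apply: (@computable_eqn F G); computability
  | |- computable (fun A x => nat_of_bool (@?F A x <= @?G A x)) =>
      apply: (@computable_leq F G); computability
  | |- computable (fun A x => nat_of_bool (~~ @?F A x)) =>
      apply: (@computable_neg F); computability
  | |- computable (fun A x => nat_of_bool (@?F A x && @?G A x)) =>
      apply: (@computable_and F G); computability
  | |- computable (fun A x => find (@?P A x) (iota 0 (@?N A x))) =>
      apply: (@computable_find P N); computability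
  | |- computable (fun A x => nat_of_bool (has (@?P A x) (iota 0 (@?N A x)))) =>
      apply: (@computable_has P N); computability
  | |- computable (fun A x => nat_of_bool (all (@?P A x) (iota 0 (@?N A x)))) =>
      apply: (@computable_all P N); computability
  | |- computable (fun A x => iteri (@?N A x) (@?G A x) (@?F A x)) =>
      apply: (@computable_iteri F G N); computability
  | |- computable (fun A x => nat_of_bool (nth false (@?S A x) (@?N A x))) =>
      apply: (@computable_nth S N); computability
  | |- computable (fun A x => size (@?S A x)) =>
      apply: (@computable_size S); computability
  | |- computable (fun A x => string_code (mkseq (@?P A x) (@?N A x))) =>
      apply: (@computable_mkseq P N); computability
  | |- computable (fun A x => string_code (string_decode (@?F A x))) =>
      apply: (@computable_decode F); computability
  | |- computable (fun A x => nat_of_bool (A (@?F A x))) =>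
      apply: (@computable_query F); computability
  | _ => first [ assumption | exact: computable_const
             | computability_hook; computability
             | match goal with
               cG : computable (fun A u => nat_of_bool (?G A (nfst u) (nsnd u)))
               |- computable (fun A x => nat_of_bool (?G A (@?X A x) (@?Y A x))) =>
                 let F := constr:(fun A x y => nat_of_bool (G A x y)) in
                 let cGXY := constr:(@computable_app2 F X Y cG) in
                 apply: cGXY; computability
               end
             | match goal with cF : computable ?F |- _ =>
                 apply: (@computable_comp F _ cF); computability
               end
             | lazymatch goal with
               | |- computable (fun A x => nat_of_bool (@?P A x)) =>
                   lazymatch P with context [if _ then _ else _] =>
                     apply: computable_ifb; computability
                   end
               | |- computable ?F =>
                   lazymatch F with context [if _ then _ else _] =>
                     apply: computable_if; computability
                   end
               end
             | idtac ]
  end.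

(** * Bounded evaluation *)

(* [ev A e t x] is [y.+1] if the search bound [t] suffices to find the output
   [y] of [e] on [x], and [0] otherwise. *)
Fixpoint ev (A : real) (e : code) (t x : nat) {struct e} : nat :=
  match e with
  | Zero => 1
  | Succ => x.+2
  | Fst => (nfst x).+1
  | Snd => (nsnd x).+1
  | Query => (nat_of_bool (A x)).+1
  | Pair f g =>
      if ev A f t x == 0 then 0 else if ev A g t x == 0 then 0 else
      (npair (ev A f t x).-1 (ev A g t x).-1).+1
  | Comp f g => if ev A g t x == 0 then 0 else ev A f t (ev A g t x).-1
  | Prec f g =>
      iteri (nsnd x) (fun n r => if r == 0 then 0 else
                        ev A g t (npair (nfst x) (npair n r.-1)))
        (ev A f t (nfst x))
  | Mu f =>
      let y := find (fun i => ev A f t (npair x i) <= 1) (iota 0 t) in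
      if y < t then if ev A f t (npair x y) == 1 then y.+1 else 0 else 0
  end.

Lemma find_iota (p : pred nat) n y : y < n ->
  find p (iota 0 n) = y <-> p y /\ forall i, i < y -> ~~ p i.
Proof.
move=> lt_yn; split=> [find_y | [py lt_y]].
  have has_p : has p (iota 0 n) by rewrite has_find size_iota find_y.
  split; first by have := nth_find 0 has_p; rewrite find_y nth_iota.
  move=> i lt_iy; have := @before_find _ 0 p (iota 0 n) i.
  by rewrite find_y nth_iota ?(ltn_trans lt_iy lt_yn) // => /(_ lt_iy) /= ->.
have has_p : has p (iota 0 n) by apply/hasP; exists y; rewrite ?mem_iota.
have lt_fn := has_p; rewrite has_find size_iota in lt_fn.
case: (ltngtP (find p (iota 0 n)) y) => // [/lt_y/negP[] | lt_yf].
  by have := nth_find 0 has_p; rewrite nth_iota.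
by have := @before_find _ 0 p _ _ lt_yf; rewrite nth_iota // add0n py.
Qed.

(** The search stops at the first value that is 0 (bound too small) or 1 (output 0), and only the
    latter is a success; so all earlier values are defined and nonzero, as [Mu] demands. *)
Lemma ev_Mu A f t x y : ev A (Mu f) t x = y.+1 <->
  [/\ y < t, ev A f t (npair x y) = 1 &
      forall i, i < y -> 1 < ev A f t (npair x i)].
Proof.
rewrite /=; set p := fun i => _; split.
  case: ltnP => // lt_t; case: eqP => // ev_1 [] eq_y.
  have [_ lt_y] := (find_iota p lt_t).1 erefl.
  rewrite eq_y in lt_t ev_1 lt_y; split=> // i /lt_y.
  by rewrite /p -ltnNge.
case=> lt_yt ev_1 lt_y.
have /(find_iota p lt_yt) -> : p y /\ forall i, i < y -> ~~ p i.
  by split=> [|i /lt_y]; rewrite /p ?ev_1 -?ltnNge.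
by rewrite lt_yt ev_1.
Qed.

(** Allows the bounds found for subcomputations to be merged by a maximum. *)
Lemma ev_mono A e t t' x y : t <= t' -> ev A e t x = y.+1 ->
  ev A e t' x = y.+1.
Proof.
move=> le_t; elim: e x y => //=
  [f IHf g IHg|f IHf g IHg|f IHf g IHg|f IHf] x y.
- case Df: (ev A f t x) => [|u] //; case Dg: (ev A g t x) => [|v] //=.
  by rewrite (IHf _ _ Df) (IHg _ _ Dg).
- by case Dg: (ev A g t x) => [|v] //= Df; rewrite (IHg _ _ Dg) /= (IHf _ _ Df).
- elim: (nsnd x) y => [|n IHn] y /=; first exact: IHf.
  case Dr: (iteri n _ _) => [|r] //= Dg.
  by rewrite (IHn _ Dr) /= (IHg _ _ Dg).
- move/(ev_Mu A f t x y).1 => [lt_yt ev_1 lt_y]; apply/(ev_Mu A f t' x y).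
  split; [exact: leq_trans le_t | exact: IHf |].
  by move=> i /lt_y; case Di: (ev A f t _) => [|[|v]] // _; rewrite (IHf _ _ Di).
Qed.

Lemma evP A e x y : eval A e x y <-> exists t, ev A e t x = y.+1.
Proof.
split; elim: e x y => [||||| f IHf g IHg|f IHf g IHg|f IHf g IHg|f IHf] x y.
all: try by move=> ->; exists 0.
all: try by case=> t [].
- move=> [u [v [/IHf[t1 D1] /IHg[t2 D2] ->]]]; exists (maxn t1 t2) => /=.
  by rewrite (ev_mono (leq_maxl _ _) D1) (ev_mono (leq_maxr _ _) D2).
- move=> [u [/IHg[t2 D2] /IHf[t1 D1]]]; exists (maxn t1 t2) => /=.
  by rewrite (ev_mono (leq_maxr _ _) D2) /= (ev_mono (leq_maxl _ _) D1).
- move=> /=; elim: (nsnd x) y => [|n IHn] y; first exact: IHf.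
  move=> [v [/IHn[t1 D1] /IHg[t2 D2]]]; exists (maxn t1 t2).
  (* Monotonicity of the recursion at stage [n] is that of [Prec f g] on a pair with second
     component [n]. *)
  have := @ev_mono A (Prec f g) _ _ (npair (nfst x) n) v (leq_maxl t1 t2).
  by rewrite /= !npairE => ->; rewrite //= (ev_mono (leq_maxr _ _) D2).
- move=> [/IHf[t1 D1] lt_y].
  (* Only finitely many values are needed, so a common bound arises by induction on [y]. *)
  have [t2 D2] : exists t, forall i, i < y -> 1 < ev A f t (npair x i).
    elim: y lt_y {D1} => [|y IHy] lt_y; first by exists 0.
    have [i lt_iy|t2 D2] := IHy; first by apply: lt_y; apply: ltnW.
    have [v /IHf[t3 D3]] := lt_y y (leqnn _); exists (maxn t2 t3) => i.
    rewrite ltnS leq_eqVlt => /predU1P[-> | /D2].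
      by rewrite (ev_mono (leq_maxr _ _) D3).
    case Di: (ev A f t2 _) => [|[|w]] // _.
    by rewrite (ev_mono (leq_maxl _ _) Di).
  exists (maxn y.+1 (maxn t1 t2)); apply/ev_Mu; split; first exact: leq_maxl.
    by apply: ev_mono D1; rewrite !leq_max leqnn orbT.
  move=> i /D2; case Di: (ev A f t2 _) => [|[|w]] // _.
  by rewrite (ev_mono _ Di) // !leq_max leqnn !orbT.
- move=> [t] /=; case Df: (ev A f t x) => [|u] //.
  case Dg: (ev A g t x) => [|v] //= [<-]; exists u, v.
  by split; [apply: IHf; exists t | apply: IHg; exists t |].
- move=> [t] /=; case Dg: (ev A g t x) => [|v] //= Df; exists v.
  by split; [apply: IHg; exists t | apply: IHf; exists t].
- move=> [t] /=; elim: (nsnd x) y => [|n IHn] y /=.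
    by move=> Df; apply: IHf; exists t.
  case Dr: (iteri n _ _) => [|r] //= Dg; exists r.
  by split; [apply: IHn | apply: IHg; exists t].
- move=> [t] /ev_Mu [_ D1 lt_y]; split; first by apply: IHf; exists t.
  move=> i /lt_y; case Di: (ev A f t _) => [|[|w]] // _; exists w.
  by apply: IHf; exists t.
Qed.

(** The code [e] is fixed, so an induction on it takes the place of a universal machine. *)
Lemma computable_ev e X Y : computable X -> computable Y ->
  computable (fun A x => ev A e (X A x) (Y A x)).
Proof.
elim: e X Y => [||||| f IHf g IHg|f IHf g IHg|f IHf g IHg|f IHf] X Y cX cY /=;
  do 4!(computability; try first [apply: (IHf) | apply: (IHg)]).
Qed.

(** * Complexity and randomness *)

(** [Mu] looks for a zero, hence the negation of [R]; since [R] is total, the search cannot get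
    stuck before the first witness. *)
Lemma semidecidable_exists (R : real -> nat -> nat -> bool) :
    computable (fun A u => R A (nfst u) (nsnd u)) ->
  exists e, forall A x, (exists y, eval A e x y) <-> exists i, R A x i.
Proof.
move=> /computable_neg[f fP]; exists (Mu f) => A x /=; split.
  by move=> [y [/fP D0 _]]; exists y; move: D0; rewrite !npairE; case: (R A x y).
move=> ex_i; have [i Ri min_i] := ex_minnP ex_i; exists i; split.
  by apply/fP; rewrite !npairE Ri.
move=> k lt_ki; exists 0; apply/fP; rewrite !npairE.
by case Rk: (R A x k) => //; have := min_i _ Rk; rewrite leqNgt lt_ki.
Qed.

(** [F] is paired with a search that halts exactly when [P] holds, and the output of the search is
    discarded. *)
Lemma partial_computable_restrict (P : real -> nat -> bool) F :
    computable (fun A x => P A x) -> computable F ->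
  exists e, forall A x y, eval A e x y <-> P A x /\ y = F A x.
Proof.
move=> cP [f fP].
have [|d dP] := @semidecidable_exists (fun A x _ => P A x).
  by computability.
exists (Comp Snd (Pair d f)) => A x y /=; split.
  move=> [u [[v [w [Dv /fP -> ->]]] ->]]; rewrite npairE; split=> //.
  by have [|] := (dP A x).1; first by exists v.
move=> [Px ->]; have [|v Dv] := (dP A x).2; first by exists 0.
exists (npair v (F A x)); rewrite npairE; split=> //.
by exists v, (F A x); split=> //; apply/fP.
Qed.

Definition computable_string (f : string -> string) : Prop :=
  computable (fun _ x => string_code (f (string_decode x))).

Lemma K_le U p s : U p = Some s -> K U s <= size p.
Proof.
rewrite /K => Up; case: pselect => [ex_n | //].
by case: ex_minnP => n _; apply; apply/asboolP; exists p.
Qed.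

Section Complexity.

Variable U : string -> option string.
Hypothesis hU : optimal_machine U.

(** Optimality is applied to [f] restricted to [D], a machine because [D] is decidable and
    prefix-free. *)
Lemma machine_complexity (D : pred string) f :
    computable (fun _ x => D (string_decode x)) -> computable_string f ->
    {in D &, forall p q, prefix p q -> p = q} ->
  exists c, forall p, D p -> exists2 q, U q = Some (f p) & size q <= size p + c.
Proof.
move=> cD cf pfD; have [e eP] := partial_computable_restrict cD cf.
have [|c cP] := proj2 hU (fun p => if D p then Some (f p) else None).
  split; last by move=> p q; case: ifP => // Dp; case: ifP => // Dq _ _; exact: pfD.
  exists e => p y; rewrite eP string_codeK.
  by case: (D p) => /=; split=> [[] // _ ->|[] // <-].
by exists c => p Dp; apply: cP; rewrite Dp.
Qed.

(** Comparison with the machine whose only program is the empty string, with output [s]. Hence [K]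
    never takes its default value. *)
Lemma optimal_machine_surj s : exists p, U p = Some s.
Proof.
have [| |p q|c /(_ [::] erefl) [p Up _]] := @machine_complexity (@nilp _) (fun=> s).
- apply: (@computable_ext (fun _ x => size (string_decode x) == 0)) => //.
  by computability.
- exact: computable_const.
- by rewrite !unfold_in => /nilP-> /nilP->.
by exists p.
Qed.

Lemma K_witness s : exists2 p, U p = Some s & size p = K U s.
Proof.
have [p Up] := optimal_machine_surj s; rewrite /K.
case: pselect => [ex_n | []]; first by case: ex_minnP => n /asboolP.
by exists (size p); apply/asboolP; exists p.
Qed.

Lemma K_machine (D : pred string) f :
    computable (fun _ x => D (string_decode x)) -> computable_string f ->
    {in D &, forall p q, prefix p q -> p = q} ->
  exists c, forall p, D p -> K U (f p) <= size p + c.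
Proof.
move=> cD cf pfD; have [c cP] := machine_complexity cD cf pfD.
by exists c => p /cP[q /K_le le_q]; apply: leq_trans.
Qed.

(** Composing [U] with [f] leaves the domain unchanged, hence prefix-free. *)
Lemma K_computable f : computable_string f ->
  exists c, forall s, K U (f s) <= K U s + c.
Proof.
move=> [e eP]; have [[d dP] pfU] := hU.1.
have [|c cP] := proj2 hU (fun p => omap f (U p)).
  split; last by move=> p q; have := pfU p q; case: (U p); case: (U q).
  exists (Comp e d) => p y /=; split.
    move=> [u [/dP Du /eP ->]]; case: (U p) Du => //= s [<-].
    by rewrite string_codeK.
  case Up: (U p) => [s|] //= [<-]; exists (string_code s).
  by rewrite dP Up eP string_codeK.
exists c => s; have [p Up <-] := K_witness s.
have [|q Uq] := cP p (f s); first by rewrite Up.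
exact/leq_trans/K_le.
Qed.

(** * Random reals have incompressible prefixes *)

Lemma stage_measure_le W m n :
    #|[set s : n.-tuple bool | `[< exists2 t, W t & prefix t s >]]| * 2 ^ m
      <= 2 ^ n ->
  (stage_measure W n <= 2%:R ^- m)%R.
Proof.
move=> le_n; rewrite /stage_measure.
rewrite Num.Theory.ler_pdivrMr ?Num.Theory.exprn_gt0 //.
rewrite GRing.mulrC Num.Theory.ler_pdivlMr ?Num.Theory.exprn_gt0 //.
by rewrite -!GRing.natrX -GRing.natrM Num.Theory.ler_nat.
Qed.

(* A string with a prefix [t] that has a short program [p] is coded, together with
   [m] arbitrary bits, by replacing [t] by [p] followed by these bits and padding
   at the end.  This is injective because [U] is prefix-free. *)
Lemma compressible_measure m : measure_le
  (fun s => exists2 p, U p = Some s & size p + m <= size s) (2%:R ^- m)%R.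
Proof.
move=> n; apply: stage_measure_le; set W := fun s => _; set B := [set s | _].
have [_ pfU] := hU.1.
pose good (s : n.-tuple bool) (x : string * string) :=
  [/\ prefix x.1 s, U x.2 = Some x.1 & size x.2 + m <= size x.1].
have /choice[x xP] : forall s, exists x, s \in B -> good s x.
  move=> s; have [Bs | nBs] := pselect (s \in B); last by exists ([::], [::]).
  have := Bs; rewrite in_set => /asboolP[t [p Up le_p] pre_t].
  by exists (t, p) => _; split.
pose h (s : n.-tuple bool) (c : m.-tuple bool) := (x s).2 ++ c ++
  drop (size (x s).1) s ++ nseq (size (x s).1 - (size (x s).2 + m)) false.
have size_h s c : s \in B -> size (h s c) == n.
  move=> /xP[/size_prefix le_t _ le_p]; move: le_t le_p.
  rewrite /h !size_cat size_drop size_nseq !size_tuple.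
  by move: (size (x s).1) (size (x s).2) => a b; lia.
(* The default of [insubd] is never taken on [B], by [size_h]. *)
pose H (sc : n.-tuple bool * m.-tuple bool) : n.-tuple bool :=
  insubd (nseq_tuple n false) (h sc.1 sc.2).
have injH : {in setX B setT &, injective H}.
  move=> [s c] [s' c'] /setXP[Bs _] /setXP[Bs' _] /(congr1 val).
  rewrite /H !val_insubd /= !size_h // => eq_h.
  have [pre Up le_p] := xP s Bs; have [pre' Up' le_p'] := xP s' Bs'.
  (* Both programs begin the same string, so one is a prefix of the other. *)
  have eq_p : (x s).2 = (x s').2.
    have [le_pp' | /ltnW le_pp'] := leqP (size (x s).2) (size (x s').2).
      apply: pfU; rewrite ?Up ?Up' // prefixE.
      have := congr1 (take (size (x s).2)) eq_h.
      by rewrite /h take_size_cat // takel_cat // => <-.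
    apply/esym/pfU; rewrite ?Up ?Up' // prefixE.
    have := congr1 (take (size (x s').2)) eq_h.
    by rewrite /h takel_cat // take_size_cat // => ->.
  have eq_t : (x s).1 = (x s').1.
    by apply: Some_inj; rewrite -Up -Up' eq_p.
  move/eqP: eq_h; rewrite /h eq_p eqseq_cat // eqxx /= eqseq_cat ?size_tuple //.
  rewrite eq_t eqseq_cat; last by rewrite !size_drop !size_tuple.
  case/and3P=> /eqP eq_c /eqP eq_drop _; congr (_, _); apply: val_inj => //=.
  move: pre pre'; rewrite !prefixE eq_t => /eqP eq_take /eqP eq_take'.
  by rewrite -(cat_take_drop (size (x s').1) s) eq_drop eq_take -{1}eq_take'
    cat_take_drop.
have := max_card (H @: setX B setT); rewrite card_in_imset //.
by rewrite cardsX cardsT !card_tuple card_bool.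
Qed.
(** One direction of Levin-Schnorr: the strings compressible by at least [m] bits form level [m] of
    a Martin-Löf test. *)
Lemma one_random_incompressible z : one_random z ->
  exists c, forall n, n <= K U (restr z n) + c.
Proof.
move=> rz; have [[d dP] _] := hU.1; apply: contrapT => no_c.
pose V m s := exists2 p, U p = Some s & size p + m <= size s.
apply: (rz V); first (split; last exact: compressible_measure).
  (* The witness [i] packs a program with a search bound for running it. *)
  pose R A x i := (ev A d (nsnd i) (nfst i) == (nsnd x).+1)
    && (size (string_decode (nfst i)) + nfst x <= size (string_decode (nsnd x))).
  have [|e eP] := @semidecidable_exists R.
    rewrite /R; computability; apply: computable_ev; computability.
  exists e => m s; rewrite eP /R !npairE string_codeK; split.
    move=> [p Up le_p].
    have /evP[t Dt] : eval no_oracle d (string_code p) (string_code s).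
      by rewrite dP Up.
    by exists (npair (string_code p) t); rewrite !npairE string_codeK Dt eqxx.
  move=> [i /andP[/eqP Di le_i]]; exists (string_decode (nfst i)) => //.
  have /dP : eval no_oracle d (string_code (string_decode (nfst i))) (string_code s).
    by rewrite string_decodeK evP; exists (nsnd i).
  by case: (U _) => //= s' [/string_code_inj->].
move=> m; apply: contrapT => nVm; apply: no_c; exists m => n.
rewrite leqNgt; apply/negP => lt_n; apply: nVm; exists n.
have [p Up size_p] := K_witness (restr z n); exists p => //.
by rewrite size_p size_mkseq ltnW.
Qed.

End Complexity.

(** * The functional *)

(* The blocks are the diagonals of the Cantor pairing: the one of index [j]
   consists of the positions [npair (j - t) t = start j + t] with [t <= j]. *)
Definition start (j : nat) : nat := npair j 0.

(** The Cantor pairing is [y] plus the triangular number of [x + y], which is [start (x + y)]. *)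
Lemma npair_start x y : npair x y = start (x + y) + y.
Proof. by rewrite [RHS]addnC [x + y]addnC. Qed.

Lemma startS j : start j.+1 = start j + j.+1.
Proof. exact: (addnC j.+1). Qed.

Lemma leq_start j k : j <= k -> start j <= start k.
Proof.
move/subnKC<-; elim: (k - j) => [|d IHd]; first by rewrite addn0.
by rewrite addnS startS (leq_trans IHd) ?leq_addr.
Qed.

Definition diag (m : nat) : nat := nfst m + nsnd m.

Lemma diagE m : m = start (diag m) + nsnd m.
Proof. by rewrite -npair_start npair_eta. Qed.

Lemma leq_nsnd_diag m : nsnd m <= diag m.
Proof. exact: leq_addl. Qed.

Lemma npair_subn j t : t <= j -> start j + t = npair (j - t) t.
Proof. by move=> le_tj; rewrite npair_start subnK. Qed.

Lemma diag_start j t : t <= j -> diag (start j + t) = j.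
Proof. by move=> le_tj; rewrite npair_subn // /diag !npairE subnK. Qed.

Lemma nsnd_start j t : t <= j -> nsnd (start j + t) = t.
Proof. by move=> le_tj; rewrite npair_subn // !npairE. Qed.

(* Only the first [width j + width j] bits of a block are moved; the minimum
   makes them fit into the block. *)
Definition width (j : nat) : nat :=
  minn (nfst j + nfst j + nfst j) (j.+1)./2.

Lemma width_block j : width j + width j <= j.+1.
Proof. by rewrite /width; lia. Qed.

(** The minimum is inactive because [npair s i] is at least the triangular number [start s], which
    is at least [6 * s] from [s = 11] on, where both are 66. *)
Lemma width_large s i : 11 <= s -> width (npair s i) = 3 * s.
Proof.
move=> le_s; rewrite /width npairE.
suff: 6 * s <= (npair s i).+1 by lia.
rewrite npair_start; have := leq_start (leq_addr i s).
suff: 6 * s <= (start s).+1 by lia.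
elim: s {i} le_s => // s IHs; rewrite leq_eqVlt => /predU1P[[<-] // | lt_s].
by have := IHs lt_s; rewrite startS; lia.
Qed.

(* From position [b] on, [g] reads [0^i 1 c 0^(a - i)] with [size c = a - 1]. *)
Definition pattern (g : nat -> bool) (b a i : nat) : bool :=
  [&& all (fun k => ~~ g (b + k)) (iota 0 i), g (b + i) &
      all (fun k => ~~ ((i + a <= k) && g (b + k))) (iota 0 (a + a))].

Lemma patternP g b a i : reflect
  [/\ forall k, k < i -> g (b + k) = false, g (b + i) &
      forall k, i + a <= k < a + a -> g (b + k) = false]
  (pattern g b a i).
Proof.
apply: (iffP and3P) => -[lt_i gi ge_i]; split=> //.
- by move=> k lt_ki; apply/negbTE/(allP lt_i); rewrite mem_iota.
- move=> k /andP[le_k lt_k]; apply/negbTE.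
  by have /(allP ge_i) : k \in iota 0 (a + a); rewrite ?mem_iota // le_k.
- by apply/allP => k; rewrite mem_iota => /lt_i ->.
- apply/allP => k; rewrite mem_iota /= add0n => lt_k.
  by apply/negP => /andP[le_k]; rewrite ge_i ?le_k.
Qed.

Lemma pattern_uniq g b a i i' :
  i <= i' -> pattern g b a i -> pattern g b a i' -> i = i'.
Proof.
move=> le_i /patternP[_ gi _] /patternP[g0 _ _].
apply/eqP; rewrite eqn_leq le_i leqNgt; apply/negP => /g0.
by rewrite gi.
Qed.

Lemma eq_pattern g h b a i : i < a + a ->
  (forall t, t < a + a -> g (b + t) = h (b + t)) ->
  pattern g b a i = pattern h b a i.
Proof.
move=> lt_i eq_gh; rewrite /pattern eq_gh //; congr [&& _, _ & _].
  by apply: eq_in_all => k; rewrite mem_iota => lt_k; rewrite eq_gh //; lia.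
by apply: eq_in_all => k; rewrite mem_iota => lt_k; rewrite eq_gh.
Qed.

(** A shift brings in 0 at offset 0 and drops the bit at offset [a + a - 1], which is 0 because
    [i < a]. In the case [i = a] the upper half moves to the front and zeros follow. *)
Definition psi (z : real) (m : nat) : bool :=
  let t := nsnd m in let b := start (diag m) in let a := width (diag m) in
  if a + a <= t then z m else
  if has (pattern z b a) (iota 0 a) then ~~ (t == 0) && z m.-1 else
  if pattern z b a a then (t.+1 <= a) && z (m + a) else z m.

(* Recovers [z] from the first [n] bits [g] of [psi z].  If the last block is
   incomplete, [mode] is the advice: 0 if the block was not changed, 1 or 2 if it
   was shifted and the bit that is lost is 0 or 1, and 3 if it was [0^a 1 c]. *)
Definition dec (mode : nat) (g : nat -> bool) (n m : nat) : bool :=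
  let t := nsnd m in let b := start (diag m) in let a := width (diag m) in
  if a + a <= t then g m else
  let k := if b + (a + a) <= n then
             if pattern g b a 0 then 3 else
             if has (fun i => pattern g b a i.+1) (iota 0 a) then 1 else 0
           else mode in
  if k == 3 then ~~ (t.+1 <= a) && g (m - a) else
  if k == 0 then g m else
  if m.+1 == minn n (b + (a + a)) then k == 2 else g m.+1.

(** [n] is the first position outside the prefix, so an incomplete block, if there is one, is that
    of [n]. A shift pushes the bit [z n.-1] out of the prefix. *)
Definition mode_of (z : real) (n : nat) : nat :=
  let b := start (diag n) in let a := width (diag n) in
  if has (pattern z b a) (iota 0 a) then if z n.-1 then 2 else 1 else
  if pattern z b a a then 3 else 0.

Section Block.

Variables (z : real) (j : nat).
Local Notation b := (start j).
Local Notation a := (width j).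

Lemma psi_off t : a + a <= t <= j -> psi z (b + t) = z (b + t).
Proof. by case/andP=> le_t le_tj; rewrite /psi diag_start // nsnd_start // le_t. Qed.

Let in_block t : t < a + a -> t <= j.
Proof. by move=> lt_t; have := width_block j; lia. Qed.

Lemma psi_shift i t : i < a -> pattern z b a i -> t < a + a ->
  psi z (b + t) = (0 < t) && z (b + t.-1).
Proof.
move=> lt_i pat lt_t; have le_t := in_block lt_t.
rewrite /psi diag_start // nsnd_start // leqNgt lt_t /=.
rewrite ifT; last by apply/hasP; exists i; rewrite // mem_iota.
by case: t {lt_t le_t} => //= t; rewrite addnS.
Qed.

Lemma psi_jump t : pattern z b a a -> t < a + a ->
  psi z (b + t) = (t < a) && z (b + t + a).
Proof.
move=> pat lt_t; have le_t := in_block lt_t.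
rewrite /psi diag_start // nsnd_start // leqNgt lt_t /= pat ifF //.
apply/negP => /hasP[i]; rewrite mem_iota /= add0n => lt_i pat_i.
by have eq_i := pattern_uniq (ltnW lt_i) pat_i pat; rewrite eq_i ltnn in lt_i.
Qed.

Lemma psi_fix t : (forall i, i <= a -> ~~ pattern z b a i) -> t <= j ->
  psi z (b + t) = z (b + t).
Proof.
move=> no_pat le_t; rewrite /psi diag_start // nsnd_start //.
case: ifP => // _; rewrite ifF ?(negbTE (no_pat a _)) //.
apply/negP => /hasP[i]; rewrite mem_iota => /ltnW le_i.
exact/negP/no_pat.
Qed.

Lemma block_cases :
  [\/ exists2 i, i < a & pattern z b a i, pattern z b a a |
      forall i, i <= a -> ~~ pattern z b a i].
Proof.
have [/hasP[i] | /hasPn no_pat] := boolP (has (pattern z b a) (iota 0 a)).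
  by rewrite mem_iota; constructor 1; exists i.
have [pat | no_pat_a] := boolP (pattern z b a a); first by constructor 2.
constructor 3 => i; rewrite leq_eqVlt => /predU1P[-> // | lt_i].
by apply: no_pat; rewrite mem_iota.
Qed.

Lemma pattern_psi_shift i : i < a -> pattern z b a i ->
  pattern (psi z) b a i.+1.
Proof.
move=> lt_i pat; have /patternP[z0 zi zl] := pat.
apply/patternP; split=> [k lt_k | | k /andP[le_k lt_k]].
- rewrite (psi_shift lt_i pat); last by lia.
  by case: k lt_k => //= k /z0.
- by rewrite (psi_shift lt_i pat) //; lia.
- rewrite (psi_shift lt_i pat) //; case: k le_k lt_k => //= k le_k lt_k.
  by apply: zl; lia.
Qed.

Lemma pattern_psi_jump : 0 < a -> pattern z b a a -> pattern (psi z) b a 0.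
Proof.
move=> a_gt0 pat; have /patternP[_ za _] := pat.
apply/patternP; split=> // [| k /andP[le_k lt_k]].
  by rewrite (psi_jump pat) ?addn0 ?a_gt0 //; lia.
by rewrite (psi_jump pat) // ltnNge le_k.
Qed.

End Block.

(** In a complete block the pattern of [psi z] reveals the case: index [i.+1] after a shift, index 0
    after the return from [0^a 1 c], and none if nothing moved. In an incomplete block the advice
    does. *)
Lemma dec_correct z n g m : (forall k, k < n -> g k = psi z k) -> m < n ->
  dec (mode_of z n) g n m = z m.
Proof.
move=> g_psi lt_mn; move: (diagE m) (leq_nsnd_diag m).
rewrite /dec; set j := diag m; set t := nsnd m => def_m le_t.
have le_2a := width_block j.
case: (leqP (width j + width j) t) => [le_at | lt_t].
  by rewrite g_psi // def_m psi_off // le_at.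
have a_gt0 : 0 < width j by lia.
pose complete := start j + (width j + width j) <= n.
have pat_g i : complete -> i <= width j ->
    pattern g (start j) (width j) i = pattern (psi z) (start j) (width j) i.
  by move=> le_n le_i; apply: eq_pattern => [|k lt_k]; last apply: g_psi; lia.
have diag_n : ~~ complete -> diag n = j.
  move=> lt_n; have -> : n = start j + (n - start j) by lia.
  by apply: diag_start; lia.
have g_in k : start j + k < n -> g (start j + k) = psi z (start j + k).
  exact: g_psi.
case: (block_cases z j) => [[i lt_i pat] | pat | no_pat].
- have has_pat : has (pattern z (start j) (width j)) (iota 0 (width j)).
    by apply/hasP; exists i; rewrite ?mem_iota.
  set k := (if _ then _ else mode_of _ _).
  (* The last available position has no successor to read: in a complete block its bit is 0 by the
     pattern, otherwise it is given by the advice. *)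
  have [k12 k_last] : k \in [:: 1; 2] /\
      (m.+1 = minn n (start j + (width j + width j)) -> (k == 2) = z m).
    rewrite /k -/complete; case: ifP => [le_n | /negbT lt_n].
      have pat1 := pattern_psi_shift lt_i pat.
      rewrite pat_g // ifF; last first.
        by apply/negP => /pattern_uniq/(_ pat1); move=> /(_ isT).
      rewrite ifT; last first.
        by apply/hasP; exists i; rewrite ?mem_iota ?pat_g.
      split=> // eq_m; have /patternP[_ _ zl] := pat.
      by rewrite def_m zl //; lia.
    rewrite /mode_of diag_n // has_pat; case Dz: (z n.-1); split=> // eq_m.
    - by have <- : n.-1 = m by (move: lt_n; rewrite -ltnNge; lia); rewrite Dz.
    - by have <- : n.-1 = m by (move: lt_n; rewrite -ltnNge; lia); rewrite Dz.
  have [-> ->] : (k == 3) = false /\ (k == 0) = false.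
    by move: k12; rewrite !inE => /orP[]/eqP->.
  case: eqP => [/k_last // | ne_m].
  have lt_m1 : m.+1 < n /\ t.+1 < width j + width j by lia.
  rewrite def_m -addnS g_in; last by lia.
  by rewrite (psi_shift lt_i pat) //; lia.
- set k := (if _ then _ else mode_of _ _); have -> : k = 3.
    rewrite /k -/complete; case: ifP => [le_n | /negbT lt_n].
      by rewrite pat_g // pattern_psi_jump.
    rewrite /mode_of diag_n // pat ifF //.
    apply/negP => /hasP[i]; rewrite mem_iota /= add0n => lt_i pat_i.
    by have eq_i := pattern_uniq (ltnW lt_i) pat_i pat; rewrite eq_i ltnn in lt_i.
  (* The first [a] bits of [z] are 0, and the bit at offset [t >= a] sits at offset [t - a] of
     [psi z], which the prefix contains. *)
  rewrite /= def_m; case: (ltnP t (width j)) => [lt_ta | le_at] /=.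
    by have /patternP[z0 _ _] := pat; rewrite z0.
  rewrite -addnBA // g_in; last by lia.
  by rewrite (psi_jump pat) ?ifT -?addnA ?subnK //; lia.
- set k := (if _ then _ else mode_of _ _); have -> : k = 0.
    rewrite /k -/complete; case: ifP => [le_n | /negbT lt_n].
      (* [psi] fixes this block, so it shows no pattern afterwards either. *)
      have no_pat_g i : i <= width j -> pattern g (start j) (width j) i = false.
        move=> le_i; rewrite pat_g // -[RHS](negbTE (no_pat i le_i)).
        by apply: eq_pattern => [|u lt_u]; rewrite ?psi_fix //; lia.
      rewrite no_pat_g // ifF //; apply/negP => /hasP[i].
      by rewrite mem_iota /= => lt_i; rewrite no_pat_g.
    rewrite /mode_of diag_n // (negbTE (no_pat _ _)) // ifF //.
    apply/negP => /hasP[i]; rewrite mem_iota /= => /ltnW le_i.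
    exact/negP/no_pat.
  by rewrite /= g_psi // def_m psi_fix.
Qed.

(** * Comparison of complexities *)

Lemma computable_minn F G : computable F -> computable G ->
  computable (fun A x => minn (F A x) (G A x)).
Proof.
move=> cF cG; apply: (@computable_ext (fun A x => F A x - (F A x - G A x))).
  by move=> A x; rewrite minnE.
by computability.
Qed.

Lemma computable_start F : computable F -> computable (fun A x => start (F A x)).
Proof. by move=> cF; rewrite /start; computability. Qed.

Lemma computable_diag F : computable F -> computable (fun A x => diag (F A x)).
Proof. by move=> cF; rewrite /diag; computability. Qed.

Lemma computable_width F : computable F -> computable (fun A x => width (F A x)).
Proof. by move=> cF; apply: computable_minn; computability. Qed.

Lemma computable_pattern (G : real -> nat -> nat -> bool) B W I :
    computable (fun A u => G A (nfst u) (nsnd u)) ->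
    computable B -> computable W -> computable I ->
  computable (fun A x => pattern (G A x) (B A x) (W A x) (I A x)).
Proof. by move=> cG cB cW cI; rewrite /pattern; computability. Qed.

Ltac computability_hook ::= first
  [ apply: computable_start | apply: computable_diag | apply: computable_width
  | apply: computable_minn | apply: computable_pattern ].

Lemma total_psi : total_turing_functional psi.
Proof.
suff [e eP] : computable (fun A x => psi A x) by exists e => z; apply: eP.
by rewrite /psi; computability.
Qed.

Lemma computable_dec (G : real -> nat -> nat -> bool) k N M :
    computable (fun A u => G A (nfst u) (nsnd u)) -> computable N ->
    computable M ->
  computable (fun A x => dec k (G A x) (N A x) (M A x)).
Proof.
by move=> cG cN cM; rewrite /dec; computability.
Qed.

Lemma mkseq_dec z n g : (forall k, k < n -> g k = psi z k) ->
  mkseq (dec (mode_of z n) g n) n = restr z n.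
Proof.
move=> g_psi; apply/eq_in_map => m; rewrite mem_iota => lt_mn.
exact: dec_correct.
Qed.

Lemma mode_of_lt z n : mode_of z n < 4.
Proof. by rewrite /mode_of; do !case: ifP. Qed.

Section Reduction.

Variable U : string -> option string.
Hypothesis hU : optimal_machine U.

(** The decoded length may exceed [size s], in which case the missing bits of [psi z] are read as
    [false]. This serves both the comparison at equal lengths and the gain at a hit. *)
Lemma K_dec (len : nat -> nat) : computable (fun _ => len) ->
  exists c, forall z s, (forall k, k < len (size s) -> nth false s k = psi z k) ->
    K U (restr z (len (size s))) <= K U s + c.
Proof.
move=> clen.
pose f k s := mkseq (dec k (nth false s) (len (size s))) (len (size s)).
have /choice[c cP] k : exists c, forall s, K U (f k s) <= K U s + c.
  apply: K_computable => //; rewrite /computable_string /f; computability.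
  by apply: computable_dec; computability.
(* There are four values of the advice, so a maximum absorbs it into the constant. *)
exists (\max_(k < 4) c k) => z s nth_s.
have lt4 := mode_of_lt z (len (size s)).
have := cP (mode_of z (len (size s))) s; rewrite /f mkseq_dec // => le_c.
apply: leq_trans le_c _; rewrite leq_add2l.
exact: (leq_bigmax (F := fun k : 'I_4 => c k) (Ordinal lt4)).
Qed.

Lemma leK_psi z : leK U z (psi z).
Proof.
have [|c cP] := @K_dec id; first exact: computable_id.
exists c => n; have := cP z (restr (psi z) n).
by rewrite size_mkseq; apply=> k lt_kn; rewrite nth_mkseq.
Qed.

(** * Complexity of prefixes at a hit *)

Definition hit (g : nat -> bool) (j : nat) : bool :=
  pattern g (start j) (width j) (width j).

(** At a hit [psi z] is 0 on the offsets from [a] to [a + a - 1], which are exactly the bits that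
    [nth] supplies by default. The length determines the block, hence the amount of padding. *)
Lemma K_after_hit : exists c, forall z j, hit z j ->
  K U (restr z (start j + (width j + width j)))
    <= K U (restr (psi z) (start j + width j)) + c.
Proof.
have [|c cP] := @K_dec (fun n => n + width (diag n)); first by computability.
exists c => z j hit_j; have := cP z (restr (psi z) (start j + width j)).
have le_2a := width_block j; rewrite size_mkseq diag_start -?addnA; last by lia.
apply=> k lt_k.
have [lt_ka | le_ak] := ltnP k (start j + width j); first by rewrite nth_mkseq.
rewrite nth_default ?size_mkseq //.
have -> : k = start j + (k - start j) by lia.
by rewrite psi_jump //; lia.
Qed.

(* The programs are [1^s 0 beta x] with [size beta = 4 * s], where [x] fills
   the positions below the block of index [npair s (string_code beta)]. *)
Lemma K_hit : exists c, forall z s beta, size beta = 4 * s ->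
  let j := npair s (string_code beta) in hit z j ->
  K U (restr z (start j + width j)) <= s.+1 + 4 * s + start j + c.
Proof.
(* The number of leading ones of [q]. *)
pose lev (q : string) := find (fun i => ~~ nth false q i) (iota 0 (size q)).
pose four n := n + n + n + n.
pose ind q := npair (lev q)
  (string_code (mkseq (fun k => nth false q ((lev q).+1 + k)) (four (lev q)))).
(* The header fixes the total length of a program, which makes [D] prefix-free. *)
pose D q := (lev q < size q) &&
  (size q == (lev q).+1 + four (lev q) + start (ind q)).
(* For [q] in [D], positions from [start (ind q)] on are read past the end of [q], where the default
   [false] supplies the zeros of the hit. *)
pose f q := mkseq (fun k => nth false q ((lev q).+1 + four (lev q) + k))
  (start (ind q) + width (ind q)).
have lev_eq q s : s < size q -> lev q = s <->
    ~~ nth false q s /\ forall i, i < s -> ~~ ~~ nth false q i.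
  exact: find_iota.
have [|||c cP] := @K_machine U hU D f.
- by rewrite /D /ind /lev /four; computability.
- by rewrite /computable_string /f /ind /lev /four; computability.
- move=> p q; rewrite !unfold_in => /andP[lt_p /eqP size_p] /andP[lt_q /eqP size_q].
  case/prefixP=> r def_q.
  have nth_q i : i < size p -> nth false q i = nth false p i.
    by move=> lt_i; rewrite def_q nth_cat lt_i.
  have eq_lev : lev q = lev p.
    have [p_s p_lt] := (lev_eq p _ lt_p).1 erefl.
    apply/lev_eq; first by rewrite def_q size_cat ltn_addr.
    split=> [|i lt_i]; first by rewrite nth_q.
    by rewrite nth_q ?p_lt // (ltn_trans lt_i).
  have eq_ind : ind q = ind p.
    rewrite /ind eq_lev; congr (npair _ (string_code _)).
    apply/eq_in_map => k; rewrite mem_iota => lt_k; apply: nth_q; lia.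
  have eq_size : size q = size p by rewrite size_q size_p eq_lev eq_ind.
  move: eq_size; rewrite def_q size_cat -[in RHS](addn0 (size p)) => /addnI.
  by move/size0nil->; rewrite cats0.
exists c => z s beta size_beta j hit_j; have le_2a := width_block j.
pose q := nseq s true ++ false :: beta ++ restr z (start j).
have size_q : size q = s.+1 + 4 * s + start j.
  by rewrite /q size_cat size_nseq /= size_cat size_beta size_mkseq; lia.
have lev_q : lev q = s.
  apply/lev_eq; first by lia.
  rewrite /q nth_cat size_nseq ltnn subnn; split=> // i lt_i.
  by rewrite nth_cat size_nseq lt_i nth_nseq lt_i.
have four_s : four s = 4 * s by rewrite /four; lia.
have nth_q k : nth false q (s.+1 + k) = nth false (beta ++ restr z (start j)) k.
  rewrite /q nth_cat size_nseq ifF; last by lia.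
  by have -> : s.+1 + k - s = k.+1 by lia.
have ind_q : ind q = j.
  rewrite /ind lev_q; congr (npair _ (string_code _)).
  apply: (@eq_from_nth _ false); rewrite size_mkseq four_s // => k lt_k.
  by rewrite nth_mkseq // nth_q nth_cat size_beta lt_k.
have f_q : f q = restr z (start j + width j).
  rewrite /f lev_q ind_q; apply/eq_in_map => k; rewrite mem_iota => lt_k.
  rewrite -addnA nth_q nth_cat size_beta four_s ifF; last by lia.
  rewrite addKn; have [lt_kj | le_jk] := ltnP k (start j).
    by rewrite nth_mkseq.
  rewrite nth_default ?size_mkseq //; have /patternP[z0 _ _] := hit_j.
  by rewrite -(subnKC le_jk) z0 //; lia.
have := cP q; rewrite f_q size_q; apply.
by rewrite /D lev_q ind_q size_q four_s eqxx andbT; lia.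
Qed.

(** * Random reals have hits *)

(** A strict bound on the codes of strings of length [4 * s]: ones give the largest code of each
    length, and there is one more of them. Sums and [mkseq] stay within the reach of
    [computability]. *)
Definition level_bound (s : nat) : nat :=
  string_code (mkseq xpredT (s + s + s + s).+1).

Lemma string_code_lt s : string_code s < string_code (mkseq xpredT (size s).+1).
Proof.
have mkseqT n : mkseq xpredT n = nseq n true.
  by apply: (@eq_from_nth _ true); rewrite !size_mkseq ?size_nseq // => i ?;
    rewrite nth_mkseq // nth_nseq if_same.
by rewrite mkseqT; elim: s => //= b s; case: b; lia.
Qed.

Definition nohit (s : nat) (g : nat -> bool) : bool :=
  all (fun i => ~~ ((size (string_decode i) == s + s + s + s)
                    && hit g (npair s i)))
    (iota 0 (level_bound s)).

Definition level_end (s : nat) : nat := start (npair s (level_bound s)).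

Lemma nohitP s g : reflect
  (forall beta, size beta = 4 * s -> ~~ hit g (npair s (string_code beta)))
  (nohit s g).
Proof.
have four_s : s + s + s + s = 4 * s by lia.
apply: (iffP allP) => [no_hit beta size_beta | no_hit i _].
  have /no_hit : string_code beta \in iota 0 (level_bound s).
    by rewrite mem_iota /level_bound four_s -size_beta string_code_lt.
  by rewrite string_codeK size_beta four_s eqxx.
apply/negP => /andP[/eqP size_i]; apply/negP.
by rewrite -[i]string_decodeK no_hit // size_i.
Qed.

(** The next block starts no later than [level_end s], so a prefix of that length decides
    [nohit s]. *)
Lemma block_end_level s i : i < level_bound s ->
  start (npair s i) + (width (npair s i) + width (npair s i)) <= level_end s.
Proof.
move=> lt_i; have := width_block (npair s i).
suff : start (npair s i).+1 <= level_end s by rewrite startS; lia.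
apply: leq_start; rewrite !npair_start.
have : start (s + i) <= start (s + level_bound s) by apply: leq_start; lia.
by lia.
Qed.

Lemma eq_hit s i g h : 11 <= s ->
  let j := npair s i in
  (forall t, t < 3 * s + 3 * s -> g (start j + t) = h (start j + t)) ->
  hit g j = hit h j.
Proof.
move=> le_s j eq_gh; have wj : width j = 3 * s by apply: width_large.
by apply: eq_pattern => [|t]; rewrite wj => *; [lia | apply: eq_gh].
Qed.

(* Overwriting the start of the block of [c] by [0^a 1] and keeping its old
   content apart is injective on the strings without a hit: the only hit of the
   new string reveals [c]. *)
Lemma nohit_measure m s : 11 <= s -> m < s -> measure_le
  (fun t => size t = level_end s /\ nohit s (nth false t)) (2%:R ^- m)%R.
Proof.
move=> le_s lt_ms n; apply: stage_measure_le; set W := fun t => _.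
set B := [set _ | _].
pose blk (c : (4 * s).-tuple bool) := start (npair s (string_code c)).
have w_blk (c : (4 * s).-tuple bool) : width (npair s (string_code c)) = 3 * s.
  exact: width_large.
have blk_lt (c : (4 * s).-tuple bool) : blk c + (3 * s + 3 * s) <= level_end s.
  rewrite -(w_blk c); apply: block_end_level.
  have -> : level_bound s = string_code (mkseq xpredT (size c).+1).
    by rewrite /level_bound size_tuple; do 3!f_equal; lia.
  exact: string_code_lt.
have BP (x : n.-tuple bool) : x \in B -> level_end s <= n /\
    forall c : (4 * s).-tuple bool, ~~ hit (nth false x) (npair s (string_code c)).
  rewrite in_set => /asboolP[t [size_t /nohitP no_hit] pre_t].
  split; first by have := size_prefix pre_t; rewrite size_t size_tuple.
  move=> c; have <- : hit (nth false t) (npair s (string_code c))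
      = hit (nth false x) (npair s (string_code c)).
    apply: eq_hit => // k lt_k.
    case/prefixP: pre_t => r ->; rewrite nth_cat size_t ifT //.
    by have := blk_lt c; rewrite /blk; lia.
  by apply: no_hit; rewrite size_tuple.
pose H (xc : n.-tuple bool * (4 * s).-tuple bool) :
    n.-tuple bool * (3 * s).+1.-tuple bool :=
  let: (x, c) := xc in
  ([tuple if blk c <= k <= blk c + 3 * s then val k == blk c + 3 * s
          else nth false x k | k < n],
   [tuple nth false x (blk c + k) | k < (3 * s).+1]).
have HE x c k : k < n -> nth false (H (x, c)).1 k =
    if blk c <= k <= blk c + 3 * s then k == blk c + 3 * s else nth false x k.
  by move=> lt_k; rewrite -[k]/(val (Ordinal lt_k)) -tnth_nth tnth_mktuple.
have H2E x c k : k <= 3 * s -> nth false (H (x, c)).2 k = nth false x (blk c + k).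
  move=> le_k; have lt_k : k < (3 * s).+1 by [].
  by rewrite -[in LHS](_ : val (Ordinal lt_k) = k) // -tnth_nth tnth_mktuple.
have H_hit x c : x \in B -> hit (nth false (H (x, c)).1) (npair s (string_code c)).
  move=> /BP[le_n _]; have le_c := blk_lt c.
  apply/patternP; rewrite w_blk -/(blk c); split.
  - by move=> k lt_k; rewrite HE; [rewrite ifT; lia | lia].
  - by rewrite HE ?ifT ?eqxx //; lia.
  - by move=> k; lia.
(* Blocks of different indices are disjoint, so a hit at [c'] other than [c] would already be a hit
   of [x]. *)
have H_only x c (c' : (4 * s).-tuple bool) : x \in B ->
    hit (nth false (H (x, c)).1) (npair s (string_code c')) -> c' = c.
  move=> Bx hit_c'; have [le_n /(_ c') no_hit] := BP _ Bx.
  apply/eqP; rewrite -val_eqE -(inj_eq string_code_inj); apply: contraNT no_hit.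
  move=> neq_c; rewrite -(@eq_hit _ _ (nth false (H (x, c)).1)) // => t lt_t.
  have le_c := blk_lt c; have le_c' := blk_lt c'; rewrite -/(blk c') HE; last by lia.
  rewrite ifF //; apply/negP => in_c.
  have diag_c : diag (blk c' + t) = npair s (string_code c').
    by apply: diag_start; have := width_block (npair s (string_code c'));
      rewrite w_blk; lia.
  have diag_c' : diag (blk c' + t) = npair s (string_code c).
    have -> : blk c' + t = blk c + (blk c' + t - blk c) by lia.
    by apply: diag_start; have := width_block (npair s (string_code c));
      rewrite w_blk; lia.
  have /(congr1 nsnd) : npair s (string_code c') = npair s (string_code c).
    by rewrite -diag_c -diag_c'.
  by rewrite !npairE => /eqP; rewrite (negbTE neq_c).
have injH : {in setX B setT &, injective H}.
  move=> [x c] [x' c'] /setXP[Bx _] /setXP[Bx' _] eq_H.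
  have eq_c : c' = c.
    by apply: (H_only x) => //; rewrite eq_H; apply: H_hit.
  rewrite eq_c in eq_H *; congr (_, _); apply: val_inj.
  apply: (@eq_from_nth _ false); rewrite !size_tuple // => k lt_k.
  have [in_k | out_k] := boolP (blk c <= k <= blk c + 3 * s).
    have -> : k = blk c + (k - blk c) by lia.
    by rewrite -!H2E ?eq_H //; lia.
  have := HE x c k lt_k; have := HE x' c k lt_k.
  by rewrite eq_H (negbTE out_k) => -> ->.
have := max_card (H @: setX B setT); rewrite card_in_imset //.
rewrite card_prod cardsX cardsT !card_tuple card_bool => le_H.
(* Injectivity bounds [#|B| * 2 ^ (4 * s)] by [2 ^ n * 2 ^ (3 * s).+1], and [m < s] gives
   [m + (3 * s).+1 <= 4 * s]. *)
rewrite -(@leq_pmul2r (2 ^ (3 * s).+1)) ?expn_gt0 //; apply: leq_trans le_H.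
rewrite -mulnA -expnD leq_mul2l leq_exp2l // orbC.
by have -> : m + (3 * s).+1 <= 4 * s by lia.
Qed.

(** The strings without a hit at level [m + (J + 12)] form level [m] of a Martin-Löf test; the shift
    by [J + 12] secures both hypotheses of [nohit_measure]. *)
Lemma one_random_hit z J : one_random z -> exists s beta,
  [/\ J <= s, size beta = 4 * s & hit z (npair s (string_code beta))].
Proof.
move=> rz; pose lev m := m + (J + 12).
pose V m t := size t = level_end (lev m) /\ nohit (lev m) (nth false t).
apply: contrapT => no_hit; apply: (rz V).
  split; last by move=> m; apply: nohit_measure; rewrite /lev; lia.
  pose P x := (size (string_decode (nsnd x)) == level_end (lev (nfst x)))
    && nohit (lev (nfst x)) (nth false (string_decode (nsnd x))).
  have [||e eP] := @partial_computable_restrict (fun _ => P) (fun _ _ => 0).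
  - rewrite /P /nohit /level_end /level_bound /hit /lev; computability.
  - exact: computable_const.
  exists e => m t; rewrite /V; split.
    move=> [size_t no_hit_t]; exists 0; apply/eP.
    by rewrite /P !npairE string_codeK size_t eqxx.
  move=> [y /eP[]]; rewrite /P !npairE string_codeK => /andP[/eqP -> ->].
  by [].
move=> m; exists (level_end (lev m)); rewrite /V size_mkseq; split=> //.
apply/nohitP => beta size_beta; apply/negP => hit_beta.
apply: no_hit; exists (lev m), beta; split=> //; first by rewrite /lev; lia.
rewrite -(@eq_hit _ _ (nth false (restr z (level_end (lev m))))) // => [|t lt_t].
  by rewrite /lev; lia.
rewrite nth_mkseq //; apply: leq_trans (block_end_level _); last first.
  rewrite (_ : level_bound _ = string_code (mkseq xpredT (size beta).+1)).
    exact: string_code_lt.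
  by rewrite /level_bound size_beta; do 3!f_equal; lia.
by rewrite ltn_add2l width_large // /lev; lia.
Qed.

(** With [n = start j] and [a = 3 * s], up to constants: [n + 6 * s] is at most the complexity of
    [z] at length [n + 2 * a], hence at most that of [psi z] and then of [z] at length [n + a],
    hence at most [n + 5 * s]. *)
Lemma not_leK_psi z : one_random z -> ~ leK U (psi z) z.
Proof.
move=> rz [c le_c].
have [c1 c1P] := one_random_incompressible hU rz.
have [c2 c2P] := K_after_hit; have [c3 c3P] := K_hit.
(* The level exceeds the sum of the four constants and the extra 1 in [s.+1]; the term 12 also
   covers the bound 11 of [width_large]. *)
have [s [beta [le_s size_beta hit_s]]] :=
  one_random_hit (c1 + c2 + c + c3 + 12) rz.
set j := npair s (string_code beta) in hit_s *.
have := c3P z s beta size_beta hit_s; have := c2P z _ hit_s.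
have := le_c (start j + width j); have := c1P (start j + (width j + width j)).
by rewrite -/j width_large; lia.
Qed.

End Reduction.

Theorem theorem1p2 (U : string -> option string) (hU : optimal_machine U) :
  exists (k : nat) (Psi : 'I_k -> real -> real),
    (forall i : 'I_k, total_turing_functional (Psi i)) /\
    forall z : real, one_random z -> exists i : 'I_k, ltK U z (Psi i z).
Proof.
(* A single functional works for all random reals. *)
exists 1, (fun _ => psi); split=> [_ | z rz]; first exact: total_psi.
by exists ord0; split; [apply: leK_psi | apply: not_leK_psi].
Qed.
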